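(* Let $E$ be an sc-Banach space and let $A\subset E$ be a linear subspace of finite codimension. Then $A$ is an sc-subspace of $E$ if and only if $A$ is closed in $E=E_0$.
   Context: All vector spaces are real. An sc-Banach space (Banach scale) $E$ is a Banach space together with a nested sequence of linear subspaces (levels) $E=E_0\supset E_1\supset E_2\supset\dots$ such that: each level $E_m$ is a Banach space under its own norm $|\cdot|_m$; each inclusion $E_m\hookrightarrow E_{m-1}$, $m\ge 1$, is a compact linear operator; and $E_\infty:=\bigcap_{m\ge 0}E_m$ is dense in every $E_m$. An sc-subspace of $E$ is a closed linear subspace $A$ of $E=E_0$ such that the intersections $A_m:=A\cap E_m$, with the norms of $E_m$, are the levels of an sc-Banach space (i.e. satisfy the three conditions above). *)

(* Defs.v *)
From HB Require Import structures.
From mathcomp Require Import all_boot all_order all_algebra.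
From mathcomp Require Import all_classical all_reals all_analysis.
Set Implicit Arguments.
Unset Strict Implicit.
Unset Printing Implicit Defensive.
Import Order.TTheory GRing.Theory Num.Theory numFieldNormedType.Exports.
Local Open Scope classical_set_scope.
Local Open Scope ring_scope.

(* A linear subspace of V with a norm of its own; only the values of ns_norm
   on ns_carrier are meaningful. *)
Record normed_subspace (R : realType) (V : lmodType R) := NormedSubspace {
  ns_carrier : set V;
  ns_norm : V -> R;
  ns_submod : submod_closed [in ns_carrier];
  ns_normD : {in ns_carrier &, forall x y,
    ns_norm (x + y) <= ns_norm x + ns_norm y};
  ns_normZ : forall a : R, {in ns_carrier, forall x,
    ns_norm (a *: x) = `|a| * ns_norm x};
  ns_norm_eq0 : {in ns_carrier, forall x, ns_norm x = 0 -> x = 0}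
}.

Section NormedSubspaceType.
Context (R : realType) (V : lmodType R) (L : normed_subspace V).

Definition ns_pred : {pred V} := [in ns_carrier L].

HB.instance Definition _ :=
  GRing.isSubmodClosed.Build R V ns_pred (ns_submod L).

(* A record of its own, so that the topology is the one of ns_norm and is not
   inherited from V. *)
Record ns_type := NsType { ns_val : V; ns_valP : ns_val \in ns_pred }.

HB.instance Definition _ := [isSub for ns_val].
HB.instance Definition _ := [Choice of ns_type by <:].
HB.instance Definition _ := [SubChoice_isSubLmodule of ns_type by <:].

Let nrm (x : ns_type) : R := ns_norm L (val x).

Let nrmD x y : nrm (x + y) <= nrm x + nrm y.
Proof. by rewrite /nrm raddfD; apply: ns_normD; apply: ns_valP. Qed.

Let nrmZ (a : R) x : nrm (a *: x) = `|a| * nrm x.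
Proof. by rewrite /nrm linearZ; apply: ns_normZ; apply: ns_valP. Qed.

Let nrm_eq0 x : nrm x = 0 -> x = 0.
Proof.
move=> x0; apply: val_inj; rewrite raddf0.
by apply: ns_norm_eq0 x0; apply: ns_valP.
Qed.

HB.instance Definition _ := Lmodule_isNormed.Build R ns_type nrmD nrmZ nrm_eq0.

End NormedSubspaceType.

Coercion ns_type : normed_subspace >-> Sortclass.

Section Inclusion.
Context (R : realType) (V : lmodType R) (L M : normed_subspace V).
Hypothesis LM : ns_carrier L `<=` ns_carrier M.

Definition ns_incl (x : L) : M :=
  NsType (mem_set (LM (set_mem (ns_valP x)))).

Let ns_incl_is_linear : linear ns_incl.
Proof. by move=> a x y; apply: val_inj. Qed.

HB.instance Definition _ :=
  GRing.isLinear.Build R L M _ ns_incl ns_incl_is_linear.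

End Inclusion.

Definition compact_operator (R : realType) (X Y : normedModType R)
    (f : {linear X -> Y}) : Prop :=
  forall B : set X, bounded_set B -> precompact (f @` B).

(* The axiom of completeType, as a property of a normed space. *)
Definition is_complete (R : realType) (X : normedModType R) : Prop :=
  forall F : set_system X, ProperFilter F -> cauchy F -> cvg F.

Record sc_levels (R : realType) (V : lmodType R)
    (E : nat -> normed_subspace V) : Prop := ScLevels {
  sc_nested : forall m, ns_carrier (E m.+1) `<=` ns_carrier (E m);
  sc_complete : forall m, is_complete (E m);
  sc_compact : forall m, compact_operator (ns_incl (@sc_nested m));
  sc_dense : forall m,
    dense [set x : E m | (\bigcap_k ns_carrier (E k)) (val x)]
}.

Record scBanach (R : realType) := ScBanach {
  sc_space :> completeNormedModType R;
  sc_level : nat -> normed_subspace sc_space;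
  sc_level0 : ns_carrier (sc_level 0) = setT;
  sc_norm0 : forall x, ns_norm (sc_level 0) x = `|x|;
  sc_levelsP : sc_levels sc_level
}.

Section Restriction.
Context (R : realType) (V : lmodType R) (A : set V).
Hypothesis A_submod : submod_closed [in A].
Variable L : normed_subspace V.

Let capP x : x \in A `&` ns_carrier L -> (x \in A) /\ (x \in ns_carrier L).
Proof. by rewrite in_setI => /andP. Qed.

Let cap_submod : submod_closed [in A `&` ns_carrier L].
Proof.
have [A0 AZ] := A_submod; have [L0 LZ] := ns_submod L.
split=> [|a x y]; first by rewrite unfold_in in_setI; apply/andP.
move=> /capP[xA xL] /capP[yA yL]; rewrite unfold_in in_setI; apply/andP.
by split; [exact: AZ | exact: LZ].
Qed.

Let capD : {in A `&` ns_carrier L &, forall x y,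
  ns_norm L (x + y) <= ns_norm L x + ns_norm L y}.
Proof. by move=> x y /capP[_ xL] /capP[_ yL]; exact: ns_normD. Qed.

Let capZ (a : R) : {in A `&` ns_carrier L, forall x,
  ns_norm L (a *: x) = `|a| * ns_norm L x}.
Proof. by move=> x /capP[_ xL]; exact: ns_normZ. Qed.

Let cap_eq0 : {in A `&` ns_carrier L, forall x, ns_norm L x = 0 -> x = 0}.
Proof. by move=> x /capP[_ xL]; exact: ns_norm_eq0. Qed.

Definition ns_cap : normed_subspace V :=
  NormedSubspace cap_submod capD capZ cap_eq0.

End Restriction.

Definition is_sc_subspace (R : realType) (E : scBanach R) (A : set E) : Prop :=
  closed A /\ exists A_submod : submod_closed [in A],
    sc_levels (fun m => ns_cap A_submod (sc_level E m)).

(* V / A is spanned by the classes of finitely many vectors. *)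
Definition finite_codim (R : realType) (V : lmodType R) (A : set V) : Prop :=
  exists (n : nat) (v : 'I_n -> V), forall x : V,
    exists c : 'I_n -> R, A (x - \sum_(i < n) c i *: v i).

(* Main.v *)
(* Each A_m is the preimage of A under the continuous inclusion E_m -> E, hence
   closed in E_m; completeness and compactness pass to closed isometric
   subspaces.  Density is by induction on the number of vectors spanning E
   modulo A.  With v one of them, A' = A + R v is closed, so A' `&` E_oo is dense
   in A'_m.  If it is not already contained in A, pick d in A' `&` E_oo outside
   A: then A' = A + R d, and the coefficient of d is a functional on A' which is
   continuous because A is closed.  Subtracting it times d from approximants in
   A' `&` E_oo of a point of A_m gives approximants in A `&` E_oo. *)
Require Import Defs.
From mathcomp Require Import all_boot all_order all_algebra.
From mathcomp Require Import all_classical all_reals all_analysis.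
From mathcomp Require Import lra.
Set Implicit Arguments.
Unset Strict Implicit.
Unset Printing Implicit Defensive.
Import Order.TTheory GRing.Theory Num.Theory numFieldNormedType.Exports.
Local Open Scope classical_set_scope.
Local Open Scope ring_scope.

(** * Linear subspaces as sets *)

Lemma submod_closed_setP (R : pzRingType) (V : lmodType R) (A : set V) :
  submod_closed [in A] <->
  A 0 /\ forall a x y, A x -> A y -> A (a *: x + y).
Proof.
split=> -[A0 AD]; split.
- by move: A0; rewrite unfold_in inE.
- move=> a x y Ax Ay.
  by have := AD a x y; rewrite !unfold_in !inE; apply.
- by rewrite unfold_in inE.
- by move=> a x y; rewrite !unfold_in !inE; exact: AD.
Qed.

Section SubmoduleSet.
Context (R : pzRingType) (V : lmodType R) (A : set V).
Hypothesis A_submod : submod_closed [in A].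

Lemma submod_set0 : A 0.
Proof. by have /submod_closed_setP[] := A_submod. Qed.

Lemma submod_setZ a x : A x -> A (a *: x).
Proof.
move=> Ax; have /submod_closed_setP[A0 AD] := A_submod.
by rewrite -[_ *: _]addr0; exact: AD.
Qed.

Lemma submod_setD x y : A x -> A y -> A (x + y).
Proof.
move=> Ax Ay; have /submod_closed_setP[_ AD] := A_submod.
by rewrite -[x]scale1r; exact: AD.
Qed.

Lemma submod_setB x y : A x -> A y -> A (x - y).
Proof. by move=> Ax Ay; rewrite -scaleN1r; apply/submod_setD/submod_setZ. Qed.

(** The subspace [A + R v], phrased through the coefficient of [v] modulo [A]. *)
Definition add_line (v : V) : set V := [set x | exists t, A (x - t *: v)].

Lemma submod_add_line v : submod_closed [in add_line v].
Proof.
apply/submod_closed_setP; split.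
  by exists 0; rewrite scale0r subr0; exact: submod_set0.
move=> a x y [t At] [s As]; exists (a * t + s).
have -> : a *: x + y - (a * t + s) *: v = a *: (x - t *: v) + (y - s *: v).
  by rewrite scalerBr scalerDl scalerA opprD addrACA.
by apply: submod_setD => //; exact: submod_setZ.
Qed.

End SubmoduleSet.

(** * Closed subspaces enlarged by a line *)

Section ClosedSubmodule.
Context (R : realType) (V : normedModType R) (A : set V).
Hypotheses (A_submod : submod_closed [in A]) (A_closed : closed A).

(** A ball of radius [e] around [d] misses [A], whereas for nonzero [t] the point [d - t^-1 *: x]
    lies in [A] at distance [|x| / |t|] from [d]. So the coefficient of [d] is a bounded functional
    on [A + R d]. *)
Lemma submod_line_dist (d : V) : ~ A d ->
  exists2 e : R, 0 < e & forall t x, A (x - t *: d) -> e * `|t| <= `|x|.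
Proof.
move=> Ad.
have : nbhs d (~` A).
  by apply: open_nbhs_nbhs; split => //; exact: closed_openC.
move=> /nbhs_ballP[e /= e0 eA]; exists e => // t x Ax.
have [->|t0] := eqVneq t 0; first by rewrite normr0 mulr0.
rewrite leNgt; apply/negP => xe.
apply: (eA (d - t^-1 *: x)).
  rewrite -ball_normE /= subKr normrZ normfV mulrC ltr_pdivrMr//.
  by rewrite normr_gt0.
have -> : d - t^-1 *: x = (- t^-1) *: (x - t *: d).
  by rewrite scalerBr scalerA mulNr mulVf// scaleN1r opprK addrC scaleNr.
exact: submod_setZ.
Qed.

Lemma closed_add_line v : closed (add_line A v).
Proof.
have [Av|Av] := pselect (A v).
  suff -> : add_line A v = A by [].
  apply/seteqP; split=> x.
    move=> [t Axt]; rewrite -[x](subrK (t *: v)).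
    by apply: submod_setD => //; exact: submod_setZ.
  by move=> Ax; exists 0; rewrite scale0r subr0.
have [e e0 He] := submod_line_dist Av.
move=> x clx.
(* The coefficient f of v is Lipschitz on A + R v, so it converges at x; its
   limit t satisfies A (x - t *: v). *)
pose F := within (add_line A v) (nbhs x).
have FF : ProperFilter F by apply: within_nbhs_proper.
(* The default 0 is taken only off [A + R v], which [F] does not see. *)
pose f y := xget 0 [set t | A (y - t *: v)].
have fP y : add_line A v y -> A (y - f y *: v).
  by move=> Ay; exact: (xgetPex 0 Ay).
have near_dist r : 0 < r -> F [set y | `|x - y| < r /\ A (y - f y *: v)].
  move=> r0; rewrite /F /within /=.
  have : nbhs x (ball x r) by exact: nbhsx_ballx.
  by apply: filterS => y; rewrite -ball_normE /= => xy /fP.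
have f_lip y z : A (y - f y *: v) -> A (z - f z *: v) ->
    e * `|f y - f z| <= `|y - z|.
  move=> Ay Az; apply: He; rewrite scalerBl opprB.
  have -> : y - z + (f z *: v - f y *: v)
      = (y - f y *: v) - (z - f z *: v).
    by rewrite opprB addrACA [RHS]addrACA [- z + _]addrC.
  exact: submod_setB.
have : cauchy (f @ F).
  apply: cauchy_exP => r r0.
  (* Points within [e * r / 2] of [x] are less than [e * r] apart, so by [f_lip] their coefficients
     are less than [r] apart. *)
  have r1 : 0 < e * r / 2 by rewrite divr_gt0 ?mulr_gt0.
  have /filter_ex[y [xy Ay]] := near_dist _ r1.
  exists (f y); rewrite nbhs_simpl /=.
  near=> z.
  have [xz Az] : `|x - z| < e * r / 2 /\ A (z - f z *: v).
    by near: z; exact: near_dist.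
  rewrite -ball_normE /= -(ltr_pM2l e0).
  apply: (le_lt_trans (f_lip _ _ Ay Az)).
  rewrite -(subrKA x) (le_lt_trans (ler_normD _ _))//.
  by rewrite (distrC y); lra.
move=> /cauchy_cvg /cvg_ex[t ft].
exists t; apply: A_closed => B /nbhs_ballP[r /= r0 rB].
(* Half of [r] is spent on [x - y] and half on [(t - f y) *: v]; the [+ 1] keeps the divisor
   positive. *)
have v0 : 0 < `|v| + 1 by rewrite ltr_wpDl.
have : F [set y | `|t - f y| < r / 2 / (`|v| + 1)].
  by move/cvgrPdist_lt : ft; apply; rewrite !divr_gt0.
have /near_dist : 0 < r / 2 by rewrite divr_gt0.
move=> /filterI /[apply] /filter_ex[y [[xy Ay] /= ty]].
exists (y - f y *: v); split => //; apply: rB; rewrite -ball_normE /=.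
have -> : x - t *: v - (y - f y *: v) = (x - y) - (t - f y) *: v.
  by by rewrite scalerBl !opprB addrACA [RHS]addrACA [- (t *: v) + _]addrC.
rewrite (le_lt_trans (ler_normB _ _))// normrZ.
have : `|t - f y| * `|v| <= r / 2.
  rewrite (le_trans (ler_wpM2r (normr_ge0 v) (ltW ty)))//.
  rewrite mulrAC ler_pdivrMr// ler_wpM2l ?lerDl//.
  by rewrite ltW// divr_gt0.
lra.
Unshelve. all: by end_near.
Qed.

End ClosedSubmodule.

(** * Density in the preimage of a closed subspace of finite codimension *)

Lemma dense_preimage (R : realType) (X Y : normedModType R)
    (j : {linear X -> Y}) (D : set X) (A : set Y) :
  continuous j -> submod_closed [in D] -> dense D ->
  submod_closed [in A] -> closed A -> finite_codim A ->
  j @^-1` A `<=` closure (D `&` j @^-1` A).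
Proof.
move=> cj D_submod D_dense + + [n [v]].
(* [A] varies because the induction hypothesis is applied to [A'], which needs one vector less. With
   no vectors left, [A] is the whole space. *)
elim: n => [|n IHn] in A v * => A_submod A_closed vA a Aa B aB.
  have [x [Bx Dx]] : B^° `&` D !=set0.
    apply: D_dense; last exact: open_interior.
    by exists a.
  exists x; split; last exact: interior_subset Bx.
  by split => //=; have [c] := vA (j x); rewrite big_ord0 subr0.
pose A' := add_line A (v ord_max).
have A'A x : A x -> A' x by exists 0; rewrite scale0r subr0.
have A'cl : a \in closure (D `&` j @^-1` A').
  rewrite inE; apply: IHn (fun i => v (widen_ord (leqnSn n) i)) _ _ _ _ _.
  - exact: submod_add_line.
  - exact: closed_add_line.
  - move=> x; have [c] := vA x; rewrite big_ord_recr /= opprD addrA => Ax.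
    by exists (fun i => c (widen_ord (leqnSn n) i)), (c ord_max).
  - exact: A'A.
have [DA'|] := pselect (D `&` j @^-1` A' `<=` j @^-1` A).
  move: A'cl; rewrite inE => /(_ B aB)[x [[Dx A'x] Bx]].
  by exists x; split => //; split => //; exact: DA'.
move=> /existsNP[d /not_implyP[[Dd [s As]] Ad]].
(* Modulo [A], [j d] is [s] times the last vector, with [s] nonzero since [j d] is outside [A];
   hence [j d] can replace that vector. *)
have A'd y : A' y -> exists t, A (y - t *: j d).
  move=> [t At]; have [s0|s0] := eqVneq s 0.
    by exfalso; apply: Ad; move: As; rewrite s0 scale0r subr0.
  exists (t / s).
  have -> : y - (t / s) *: j d
      = (y - t *: v ord_max) - (t / s) *: (j d - s *: v ord_max).
    by rewrite scalerBr scalerA divfK// opprB addrA addrNK.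
  by apply: submod_setB => //; exact: submod_setZ.
have [e e0 He] := submod_line_dist A_submod A_closed Ad.
have /(linear_boundedP j)/pinfty_ex_gt0[C C0 jC] :=
  continuous_linear_bounded 0 (cj 0).
move: aB => /nbhs_ballP[r /= r0 rB].
(* Passing from [x] to [x - t *: d] multiplies the distance to [a] by at most [k]. *)
pose k := 1 + C / e * `|d|.
have k0 : 0 < k by rewrite ltr_pwDl// mulr_ge0// ltW// divr_gt0.
have : nbhs a (ball a (r / k)) by apply: nbhsx_ballx; rewrite divr_gt0.
move: A'cl; rewrite inE => /[apply] -[x [[Dx /A'd[t At]]]].
rewrite -ball_normE /= => ax.
exists (x - t *: d); split.
  split; first by apply: submod_setB => //; exact: submod_setZ.
  by rewrite /preimage /= linearB linearZ.
apply: rB; rewrite -ball_normE /= opprB addrCA addrC.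
(* As [j a] is in [A], [t] is also a coefficient of [j d] in [j (x - a)]. *)
have tC : `|t| <= C / e * `|a - x|.
  rewrite mulrAC ler_pdivlMr// mulrC distrC; apply: le_trans (jC _).
  by apply: He; rewrite linearB addrAC; exact: submod_setB.
rewrite (le_lt_trans (ler_normD _ _))// normrZ.
apply: (@le_lt_trans _ _ (`|a - x| * k)); last by rewrite -ltr_pdivlMr.
rewrite /k mulrDr mulr1 lerD2l (le_trans (ler_wpM2r _ tC))//.
by rewrite mulrAC mulrC.
Qed.

(** * Completeness and precompactness along isometries with closed range *)

Section IsometricTransfer.
Context (R : realType) (X Y : normedModType R) (f : {linear X -> Y}).
Hypothesis f_isometry : forall x, `|f x| = `|x|.
Hypothesis f_closed : closed (range f).

Let f_ball x y e : ball (f x) e (f y) = ball x e y.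
Proof. by rewrite -!ball_normE /= -linearB f_isometry. Qed.

Lemma isometry_complete : is_complete Y -> is_complete X.
Proof.
move=> Ycomplete F FF Fc.
have : cvg (f @ F).
  apply: Ycomplete; apply/cauchy_ballP => e e0.
  have /cauchy_ballP/(_ e e0) := Fc.
  move=> [[P Q] /= [FP FQ] PQ]; exists (f @` P, f @` Q) => /=.
    split; [apply: filterS FP|apply: filterS FQ];
      by move=> x Px; exists x.
  by move=> [_ _] [/= [x Px <-] [y Qy <-]]; rewrite f_ball; exact: (PQ (x, y)).
move=> /cvg_ex[/= y fy].
have [x _ xy] : range f y.
  apply: f_closed => B /fy FB.
  have /filter_ex[x Bx] : F (f @^-1` B) := FB.
  by exists (f x); split => //; exists x.
apply/cvg_ex; exists x => P /nbhs_ballP[e /= e0 eP].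
have : F (f @^-1` ball (f x) e) by apply: fy; rewrite -xy; exact: nbhsx_ballx.
by apply: filterS => z; rewrite /preimage /= f_ball; exact: eP.
Qed.

Lemma isometry_precompact (B : set X) : precompact (f @` B) -> precompact B.
Proof.
rewrite !precompactE => cfB F FF FB.
have clf : closure B `<=` f @^-1` closure (f @` B).
  move=> x clx P /nbhs_ballP[e /= e0 eP].
  have [z [Bz xz]] := clx _ (nbhsx_ballx x e e0).
  by exists (f z); split; [exists z|apply: eP; rewrite f_ball].
have fFB : (f @ F) (closure (f @` B)) by exact: filterS clf FB.
have [y [fBy Fy]] := cfB _ _ fFB.
have [x _ xy] : range f y.
  apply: f_closed => P /fBy[_ [[z Bz <-] Pz]].
  by exists (f z); split => //; exists z.
(* A cluster point of the image filter lies in the closed range, and balls correspond under [f], so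
   its preimage is a cluster point of [F]. *)
have xF : cluster F x.
  move=> P Q FP /nbhs_ballP[e /= e0 eQ].
  have : (f @ F) (f @` P) by exact: filterS (@preimage_image _ _ f P) FP.
  move=> /Fy/(_ (nbhsx_ballx y e e0))[_ [[z Pz <-]]].
  by rewrite -xy f_ball => /eQ Qz; exists z.
exists x; split => //.
by apply: closed_closure => Q /(xF _ _ FB).
Qed.

End IsometricTransfer.

(** The image of a ball has compact, hence bounded, closure. *)
Lemma compact_operator_continuous (R : realType) (X Y : normedModType R)
    (f : {linear X -> Y}) :
  compact_operator f -> continuous f.
Proof.
move=> cf; apply/linear_bounded_continuous/bounded_funP => r.
have : precompact (f @` [set x | `|x| <= r]).
  apply: cf; exists r; split=> [|M rM x /= xr]; first exact: num_real.
  exact: le_trans xr (ltW rM).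
rewrite precompactE => /compact_bounded[M [_ HM]].
exists (M + 1) => x xr; apply: (HM (M + 1)); first by rewrite ltrDl.
by apply: subset_closure; exists x.
Qed.

(** * The scale induced on a closed subspace *)

Section RestrictedScale.
Context (R : realType) (E : scBanach R) (A : set E).
Hypotheses (A_submod : submod_closed [in A]) (A_closed : closed A).

Local Notation L := (sc_level E).
Local Notation LA := (fun m => ns_cap A_submod (L m)).

(** Level 0 carries the norm of [E], and each further level is reached through a compact, hence
    continuous, inclusion. *)
Lemma sc_val_continuous m : continuous (val : L m -> E).
Proof.
elim: m => [|m IHm].
  apply/linear_bounded_continuous/bounded_funP => r; exists r => x.
  by rewrite -(sc_norm0 (val x)).
pose i := ns_incl (sc_nested (sc_levelsP E) (m := m)).
rewrite (_ : val = val \o i)// => x; apply: continuous_comp; last exact: IHm.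
apply: compact_operator_continuous; exact: sc_compact.
Qed.

Let capS m : ns_carrier (LA m) `<=` ns_carrier (L m) := @subIsetr _ _ _.

Let norm_cap m x : `|ns_incl (@capS m) x| = `|x|.
Proof. by []. Qed.

Let range_cap m : range (ns_incl (@capS m)) = val @^-1` A.
Proof.
apply/seteqP; split=> [_ [x _ <-]|x Ax].
  by have /set_mem[] := ns_valP x.
have xP : val x \in ns_carrier (LA m).
  by rewrite inE; split => //; exact: set_mem (ns_valP x).
by exists (NsType xP) => //; exact: val_inj.
Qed.

Let closed_range_cap m : closed (range (ns_incl (@capS m))).
Proof.
rewrite range_cap; apply: closed_comp => // x _.
exact: sc_val_continuous.
Qed.

Lemma sc_levels_cap : finite_codim A -> sc_levels LA.
Proof.
move=> A_codim.
have [nestedE completeE compactE denseE] := sc_levelsP E.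
have nestedA m : ns_carrier (LA m.+1) `<=` ns_carrier (LA m).
  by apply: setIS; exact: nestedE.
apply: (ScLevels (sc_nested := nestedA)) => m.
- exact: isometry_complete (@norm_cap m) (@closed_range_cap m) (completeE m).
- move=> B B_bounded.
  apply: (isometry_precompact (@norm_cap m) (@closed_range_cap m)).
  (* Both ways around the square of inclusions from [LA m.+1] to [L m] agree, so compactness in [E]
     applies. *)
  have -> : ns_incl (@capS m) @` (ns_incl (@nestedA m) @` B)
      = ns_incl (@nestedE m) @` (ns_incl (@capS m.+1) @` B).
    by rewrite !image_comp; congr image; apply/funext => x; exact: val_inj.
  apply: compactE; move: B_bounded => [M [Mreal BM]].
  by exists M; split => // N MN _ [x Bx <-]; exact: (BM N MN).
- move=> O [x Ox] O_open.
  have : nbhs x O by exact: open_nbhs_nbhs.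
  move=> /nbhs_ballP[e /= e0 eO].
  pose D := [set y : L m | (\bigcap_k ns_carrier (L k)) (val y)].
  have D_submod : submod_closed [in D].
    apply/submod_closed_setP; split=> [k _|a y z Dy Dz k _].
      by rewrite raddf0; exact: submod_set0 (ns_submod (L k)).
    rewrite linearP; have /submod_closed_setP[_] := ns_submod (L k).
    by apply; [exact: Dy|exact: Dz].
  have Ax : A (val x) by have /set_mem[] := ns_valP x.
  have := @dense_preimage _ _ _ (val : {linear L m -> E}) D A
    (@sc_val_continuous m) D_submod (denseE m) A_submod A_closed A_codim
    (ns_incl (@capS m) x) Ax.
  move=> /(_ _ (nbhsx_ballx _ e e0))[y [[Dy Ay] xy]].
  have yP : val y \in ns_carrier (LA m).
    by rewrite inE; split => //; exact: Dy.
  exists (NsType yP); split; last by move=> k _; split => //; exact: Dy.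
  by apply: eO; move: xy; rewrite -!ball_normE.
Qed.

End RestrictedScale.

Theorem lemma2p3p21 (R : realType) (E : scBanach R) (A : set E)
    (A_submod : submod_closed [in A]) (A_codim : finite_codim A) :
  is_sc_subspace A <-> closed A.
Proof.
split=> [[]//|A_closed]; split => //.
by exists A_submod; exact: sc_levels_cap.
Qed.
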